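(* Let $(p,q)\in\mathbb{N}^2$. For $n\in\mathbb{N}$ with $n\ge p+q$, we have $$|S^{p/q}_{n}| \;=\; \sum_{k=1}^{q} (-1)^{k+1}\binom{q}{k}\,|S^{p/q}_{n-k}| \;+\; |S^{p/q}_{n-(p+q)}|.$$
   Context: $\mathbb{N}=\{1,2,3,\dots\}$. For $(p,q)\in\mathbb{N}^2$ and an integer $m\ge 0$, define $$S^{p/q}_m=\{F\subset\mathbb{N} : F \text{ finite nonempty},\ q\min F\ge p|F| \text{ and } \max F=m\},$$ where $|F|$ denotes the cardinality of $F$. In particular $S^{p/q}_0=\emptyset$, since no subset of $\mathbb{N}$ has maximum $0$. *)

(* Defs.v *)
From mathcomp Require Export all_boot all_order all_algebra.
From mathcomp Require Export finmap.
Set Implicit Arguments.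
Unset Strict Implicit.
Unset Printing Implicit Defensive.

Open Scope fset_scope.

Definition fsmax (F : {fset nat}) : nat := \max_(i <- F) i.

(* [minn] has no neutral element on nat; the maximum of F is a harmless initial
   value as soon as F is nonempty, see [fsmin_in] and [fsmin_le]. *)
Definition fsmin (F : {fset nat}) : nat := \big[minn/fsmax F]_(i <- F) i.

(* S^{p/q}_m. Restricting F to subsets of {1, ..., m} makes the collection a
   finite set and loses nothing, see [schreierP]. *)
Definition schreier (p q m : nat) : {fset {fset nat}} :=
  [fset F in fpowerset [fset i in iota 1 m]
     | [&& F != fset0, p * #|` F| <= q * fsmin F & fsmax F == m]].

Lemma fsmax_ge (F : {fset nat}) (i : nat) : i \in F -> i <= fsmax F.
Proof. by move=> iF; rewrite /fsmax (big_rem i) //= leq_maxl. Qed.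

Lemma fsmax_in (F : {fset nat}) : F != fset0 -> fsmax F \in F.
Proof.
case/fset0Pn=> j jF; rewrite /fsmax.
have H (s : seq nat) : s != [::] -> \max_(i <- s) i \in s.
  elim: s => [//|x s IH] _; rewrite big_cons inE.
  case: (s =P [::]) => [->|/eqP/IH Hs]; first by rewrite big_nil maxn0 eqxx.
  by rewrite /maxn; case: ifP; rewrite ?eqxx // Hs orbT.
by apply: (H (enum_fset F)); apply: contraTneq jF => s0; rewrite -[j \in F]/(j \in enum_fset F) s0.
Qed.

Lemma fsmin_in (F : {fset nat}) : F != fset0 -> fsmin F \in F.
Proof.
move=> F0; rewrite /fsmin big_seq.
by elim/big_ind: _ => [|x y xF yF|//]; [exact: fsmax_in | rewrite /minn; case: ifP].
Qed.

Lemma fsmin_le (F : {fset nat}) (i : nat) : i \in F -> fsmin F <= i.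
Proof.
rewrite /fsmin; move: (fsmax F) => d.
have H (s : seq nat) : i \in s -> \big[minn/d]_(j <- s) j <= i.
  elim: s => [//|x s IH]; rewrite inE big_cons.
  by case/orP=> [/eqP->|/IH le]; rewrite geq_min ?leqnn // le orbT.
exact: (H (enum_fset F)).
Qed.

Lemma schreierP (p q m : nat) (F : {fset nat}) :
  reflect [/\ 0 \notin F, F != fset0, p * #|` F| <= q * fsmin F & fsmax F = m]
          (F \in schreier p q m).
Proof.
rewrite /schreier !inE /= fpowersetE.
apply: (iffP andP) => [[/fsubsetP sF /and3P[F0 le /eqP mF]] | [N0 F0 le mF]].
  by split=> //; apply/negP=> /sF; rewrite !inE /= mem_iota.
split; last by rewrite F0 le mF eqxx.
apply/fsubsetP=> i iF; rewrite !inE /=.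
rewrite mem_iota add1n ltnS -mF fsmax_ge // andbT lt0n.
by apply: contraNneq N0 => <-.
Qed.

(* Main.v *)
Require Import Defs.
From mathcomp Require Import all_boot all_order all_algebra finmap.
From mathcomp Require Import zify.
Import GRing.Theory.
Local Open Scope ring_scope.

(* A set of size [s] and maximum [m] lies in S^{p/q}_m iff its other elements
   form an [s-1]-subset of the interval [c s, m), where [c s] is the ceiling of
   [p s / q]; hence |S^{p/q}_m| is the sum over [s] of C(m - c s, s - 1).  The
   q-th backward difference in [m] turns the summand of index [s] into
   C(m - q - c s, s - 1 - q), which vanishes for [s <= q].  As
   [c (s + q) = c s + p], shifting the index [s] by [q] then gives
   |S^{p/q}_(m - (p + q))|. *)

(** Subsets of [A] correspond, through [val], to sets over the finite type of elements of [A], where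
    [card_draws] counts them. *)
Lemma card_fpowerset_size (K : choiceType) (A : {fset K}) (k : nat) :
  #|` [fset X in fpowerset A | #|` X| == k]| = 'C(#|` A|, k).
Proof.
have cardv (Y : {set A}) : #|` [fsetval y in Y]| = #|Y|.
  by rewrite card_imfset /= -?cardE //; apply: val_inj.
have -> : [fset X in fpowerset A | #|` X| == k] =
    [fset [fsetval y in Y : {set A}] | Y in [set Y : {set A} | #|Y| == k]].
  apply/fsetP => X; rewrite !inE /= fpowersetE.
  apply/andP/imfsetP => /= [[XA /eqP cX]|[Y]].
    exists (fsub A X); last by rewrite fsubK.
    by rewrite inE -cardv fsubK // cX.
  rewrite inE => /eqP <- ->; rewrite cardv eqxx; split=> //.
  by apply/fsubsetP => x /imfsetP[/= y _ ->]; apply: valP.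
rewrite card_imfset /=; first by rewrite -cardE card_draws cardfE.
move=> Y Z /fsetP eqYZ; apply/setP => a.
have := eqYZ (val a).
by rewrite !mem_imfset //; apply: val_inj.
Qed.

Definition schreier_bound (p q s : nat) : nat := ((p * s + q.-1) %/ q)%N.

Lemma schreier_bound_le (p q s x : nat) : (0 < q)%N ->
  (schreier_bound p q s <= x)%N = (p * s <= q * x)%N.
Proof.
move=> q0; rewrite /schreier_bound -ltnS ltn_divLR //.
by rewrite mulSn (mulnC x); apply/idP/idP; lia.
Qed.

Lemma schreier_bound_gt0 (p q s : nat) : (0 < p)%N -> (0 < q)%N -> (0 < s)%N ->
  (0 < schreier_bound p q s)%N.
Proof.
by move=> p0 q0 s0; rewrite ltnNge schreier_bound_le // muln0 -ltnNge muln_gt0 p0.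
Qed.

Lemma schreier_bound_shift (p q s : nat) : (0 < q)%N ->
  schreier_bound p q (s + q) = (schreier_bound p q s + p)%N.
Proof.
by move=> q0; rewrite /schreier_bound mulnDr addnAC addnC divnMDl // addnC.
Qed.

(** The test [c <= m] matters only for [r = 0]: truncated subtraction would give ['C(0, 0) = 1] for
    [m < c], where no set exists. *)
Definition tbin (m c r : nat) : nat := if (c <= m)%N then 'C(m - c, r) else 0%N.

Lemma card_schreier_size (p q m r : nat) : (0 < p)%N -> (0 < q)%N ->
  #|` [fset F in schreier p q m | #|` F| == r.+1]| =
  tbin m (schreier_bound p q r.+1) r.
Proof.
move=> p0 q0; rewrite /tbin.
move: (schreier p q m) (schreierP p q m) => S SP.
set c := schreier_bound p q r.+1.
have c0 : (0 < c)%N by apply: schreier_bound_gt0.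
case: ifPn => [cm|]; last first.
  rewrite -ltnNge => mc; apply/eqP; rewrite cardfs_eq0; apply/eqP/fsetP => F.
  rewrite !inE; apply/negP => /andP[/SP[_ F0 le Fm] /eqP cF].
  move: le; rewrite cF -schreier_bound_le // -/c => cmin.
  by have := leq_trans mc (leq_trans cmin (fsmin_le (fsmax_in F0))); rewrite Fm ltnn.
pose I := [fset i in iota c (m - c)].
have II i : (i \in I) = (c <= i < m)%N by rewrite !inE /= mem_iota subnKC.
have cardI : #|` I| = (m - c)%N.
  by rewrite card_fseq undup_id ?iota_uniq // size_iota.
have mI (X : {fset nat}) : X `<=` I -> m \notin X.
  by move=> /fsubsetP XI; apply/negP => /XI; rewrite II ltnn andbF.
rewrite -cardI -card_fpowerset_size.
(* Removing the maximum [m] is a bijection onto the [r]-subsets of [I], the interval from [c] to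
   [m - 1]. *)
have -> : [fset F in S | #|` F| == r.+1] =
    [fset m |` X | X in [fset X in fpowerset I | #|` X| == r]].
  apply/fsetP => F; rewrite !inE.
  apply/andP/imfsetP => /= [[/SP[F1 F0 le Fm] /eqP cF]|[X]].
    have mF : m \in F by rewrite -Fm fsmax_in.
    exists (F `\ m); last by rewrite fsetD1K.
    rewrite !inE fpowersetE.
    move: (cardfsD1 m F); rewrite cF mF => -[->]; rewrite eqxx andbT.
    apply/fsubsetP => i; rewrite !in_fsetD1 => /andP[im iF].
    rewrite II ltn_neqAle im -Fm fsmax_ge // !andbT.
    apply: leq_trans (fsmin_le iF).
    by rewrite schreier_bound_le // -cF.
  rewrite !inE fpowersetE => /andP[XI /eqP cX ->].
  have cF : #|` m |` X| = r.+1 by rewrite cardfsU1 mI // cX.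
  have F0 : m |` X != fset0 by rewrite -cardfs_gt0 cF.
  have inF i : i \in m |` X -> (c <= i <= m)%N.
    rewrite in_fset1U => /predU1P[->|/(fsubsetP XI)]; first by rewrite cm leqnn.
    by rewrite II => /andP[-> /ltnW].
  rewrite cF; split=> //; apply/SP; split=> //.
  - by apply/negP => /inF /andP[]; rewrite leqNgt c0.
  - rewrite cF -schreier_bound_le //.
    by have /andP[] := inF _ (fsmin_in F0).
  - apply/eqP; rewrite eqn_leq fsmax_ge ?fset1U1 // andbT.
    by have /andP[] := inF _ (fsmax_in F0).
rewrite card_in_imfset //= => X Y.
rewrite !inE !fpowersetE => /andP[XI _] /andP[YI _] eqXY.
by rewrite -(fsetU1K (mI _ XI)) eqXY fsetU1K // mI.
Qed.

(** A set counted here has at most [m] elements, so any [N >= m] bounds the index. This freedom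
    gives all the [n - k] a common range of summation. *)
Lemma card_schreier (p q m N : nat) : (0 < p)%N -> (0 < q)%N -> (m <= N)%N ->
  #|` schreier p q m| =
  (\sum_(r < N) tbin m (schreier_bound p q r.+1) r)%N.
Proof.
move=> p0 q0 mN.
under eq_bigr do rewrite -card_schreier_size // card_fset_sum1.
rewrite card_fset_sum1.
under [RHS]eq_bigr do rewrite -big_fset_condE /= big_mkcond.
rewrite exchange_big /= big_seq [RHS]big_seq; apply: eq_bigr => F.
rewrite !inE /= fpowersetE => /andP[/fsubset_leq_card].
rewrite card_fseq undup_id ?iota_uniq // size_iota => cF /and3P[].
rewrite -cardfs_gt0 => F0 _ _.
have ltF : (#|` F|.-1 < N)%N by lia.
rewrite -big_mkcond /= (big_pred1 (Ordinal ltF)) // => r.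
by rewrite /= -val_eqE /= -{1}(prednK F0) eqSS eq_sym.
Qed.

(** Pascal's rule splits each coefficient; the difference of order [q.+1] is the one of order [q]
    applied to first differences. *)
Lemma backward_diffS (f : nat -> int) (q : nat) :
  \sum_(k < q.+2) (-1) ^+ k * 'C(q.+1, k)%:Z * f k =
  \sum_(k < q.+1) (-1) ^+ k * 'C(q, k)%:Z * (f k - f k.+1).
Proof.
under [RHS]eq_bigr do rewrite mulrBr.
rewrite sumrB [in RHS]big_ord_recl /= big_ord_recl /= !bin0 -addrA; congr (_ + _).
rewrite -sumrN.
(* The added top term vanishes because ['C(q, q.+1) = 0]. *)
have -> : \sum_(i < q) (-1) ^+ bump 0 i * 'C(q, bump 0 i)%:Z * f (bump 0 i) =
    \sum_(i < q.+1) (-1) ^+ bump 0 i * 'C(q, bump 0 i)%:Z * f (bump 0 i).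
  by rewrite big_ord_recr /= bin_small // mulr0 mul0r addr0.
rewrite -big_split /=; apply: eq_bigr => i _.
by rewrite /bump /= add1n binS PoszD exprS mulN1r !mulNr mulrDr mulrDl opprD.
Qed.

(** Pascal's rule survives the truncation because the lower index is positive: at [c = n.+1] both
    sides are 0. *)
Lemma tbinS (n c r : nat) : tbin n.+1 c r.+1 = (tbin n c r.+1 + tbin n c r)%N.
Proof.
rewrite /tbin; case: (ltngtP c n.+1) => [|lt|->].
- by rewrite ltnS => cn; rewrite cn subSn // binS.
- by rewrite leqNgt (ltnW lt).
- by rewrite ltnn subnn.
Qed.

Lemma tbin_addr (n c p r : nat) : (p <= n)%N -> tbin n (c + p) r = tbin (n - p) c r.
Proof. by move=> pn; rewrite /tbin leq_subRL // (addnC c) subnDA. Qed.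

(* The hypothesis keeps the difference of [C(x, r)], [r < q], away from the
   points near [x = 0] where the truncation to [0] for [x < 0] is visible. *)
Lemma tbin_diff (c q n r : nat) : (q <= n)%N -> (c + q <= n)%N || (q <= r)%N ->
  \sum_(k < q.+1) (-1) ^+ k * 'C(q, k)%:Z * (tbin (n - k) c r)%:Z =
  if (q <= r)%N then (tbin (n - q) c (r - q))%:Z else 0.
Proof.
elim: q n r => [|q IH] n r qn hyp.
  by rewrite big_ord1 /= !subn0 !mul1r.
rewrite (backward_diffS (fun k => (tbin (n - k) c r)%:Z)).
have nk (k : 'I_q.+1) : (n - k = (n.-1 - k).+1)%N by have := ltn_ord k; lia.
case: r hyp => [|r] hyp.
  (* With [r = 0], [hyp] keeps every point at or above [c], where [tbin] is constantly 1. *)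
  rewrite big1 // => k _; have kq := ltn_ord k.
  by rewrite /tbin !ifT ?bin0 ?subrr ?mulr0 //; lia.
(* By Pascal's rule a first difference lowers both [n] and [r] by one. *)
under eq_bigr => k _.
  rewrite subnS nk /= tbinS PoszD addrAC subrr add0r; over.
rewrite IH ?ltnS; [|lia|lia].
by rewrite subSS; case: ifP => // _; congr (tbin _ _ _)%:Z; lia.
Qed.

Theorem theorem1p1 (p q : nat) (hp : (0 < p)%N) (hq : (0 < q)%N)
  (n : nat) (hn : (p + q <= n)%N) :
  (#|` schreier p q n|)%:Z =
    \sum_(1 <= k < q.+1)
      (-1) ^+ (k + 1)%N * ('C(q, k))%:Z * (#|` schreier p q (n - k)%N|)%:Z
    + (#|` schreier p q (n - (p + q))%N|)%:Z.
Proof.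
(* With all terms in [n - k] on one side, the left-hand side of the theorem is the term [k = 0] of a
   backward difference of order [q]. *)
suff main : \sum_(k < q.+1) (-1) ^+ k * 'C(q, k)%:Z * (#|` schreier p q (n - k)|)%:Z
    = (#|` schreier p q (n - (p + q))|)%:Z.
  move: main; rewrite -(big_mkord xpredT
    (fun k => (-1) ^+ k * 'C(q, k)%:Z * (#|` schreier p q (n - k)|)%:Z)).
  rewrite big_ltn // bin0 subn0 !mul1r => <-.
  rewrite addrCA -big_split /= big1 ?addr0 // => k _.
  by rewrite addn1 exprS mulN1r !mulNr addNr.
pose c r := schreier_bound p q r.+1.
have sumE (m : nat) : (m <= n)%N ->
    (#|` schreier p q m|)%:Z = \sum_(r < n) (tbin m (c r) r)%:Z.
  by move=> mn; rewrite (card_schreier _ _ _ _ hp hq mn) (big_morph Posz PoszD (erefl _)).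
under eq_bigr do rewrite sumE ?leq_subr // mulr_sumr.
rewrite exchange_big /=.
(* For [r < q] this yields [c r + q <= p + q <= n], the side condition of [tbin_diff]. *)
have cq r : (r < q)%N -> (c r <= p)%N.
  by move=> rq; rewrite schreier_bound_le // mulnC leq_mul2r rq orbT.
have qn : (q <= n)%N by lia.
under eq_bigr => r _.
  rewrite tbin_diff //; last first.
    by case: (ltnP r q) => [/cq|]; lia.
  over.
(* The range [n - q] matches what remains of [r < n] once the zero terms [r < q] are dropped and [r]
   is shifted by [q]. *)
rewrite (card_schreier _ _ _ _ hp hq (_ : _ <= n - q)%N); last by lia.
rewrite (big_morph Posz PoszD (erefl _)).
rewrite -(big_mkord xpredT (fun r => if (q <= r)%N then (tbin (n - q) (c r) (r - q))%:Z else 0)).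
rewrite (big_cat_nat _ (n := q)) //= big_nat big1 ?add0r; last first.
  by move=> r /andP[_ rq]; rewrite leqNgt rq.
rewrite -{1}[q]add0n big_addn big_mkord; apply: eq_bigr => r _.
rewrite leq_addl addnK /c -addSn schreier_bound_shift // tbin_addr; last by lia.
by rewrite -subnDA (addnC q).
Qed.
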